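(* Let $a\ge 1$ and $m\ge 0$ be integers. Let $f_0$ be defined by $f_0(1)=1$, $f_0(2)=0$, and $f_0(n+2)=af_0(n)$ for $n\ge 1$, and let $f_m$ be the $m$-th invert transform of $f_0$. Then for every $n\ge 1$, $$f_m(n)=\sum_{j=0}^{\lfloor\frac{n-1}{2}\rfloor}m^{n-2j-1}a^{j}\binom{n-1-j}{j}.$$
   Context: For an arithmetic function $f_0$ defined on the positive integers, the functions $f_m$ ($m\ge 1$) are defined recursively by $f_m(n)=\sum_{k=1}^n\ \sum_{i_1+\cdots+i_k=n} f_{m-1}(i_1)\cdots f_{m-1}(i_k)$, where the inner sum is over positive integers $i_1,\ldots,i_k$. Convention: $0^0=1$. *)

(* Defs.v *)
From HB Require Import structures.
From mathcomp Require Import all_boot all_order all_algebra.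
Set Implicit Arguments.
Unset Strict Implicit.
Unset Printing Implicit Defensive.
Import GRing.Theory.
Local Open Scope ring_scope.

(* An arithmetic function is f : nat -> R whose value at 0 is irrelevant.
   The inner sum ranges over all k-tuples of positive integers with sum n;
   each entry of such a tuple is at most n, hence the finite type 'I_n.+1. *)
Definition invert (R : pzSemiRingType) (f : nat -> R) (n : nat) : R :=
  \sum_(1 <= k < n.+1)
    \sum_(i : {ffun 'I_k -> 'I_n.+1} |
            [forall j, (0 < i j)%N] && ((\sum_(j < k) (i j : nat))%N == n))
      \prod_(j < k) f (i j).

(* Main.v *)
Require Import Defs.
From mathcomp Require Import all_boot all_order all_algebra.
From mathcomp Require Import zify ring.
Set Implicit Arguments.
Unset Strict Implicit.
Unset Printing Implicit Defensive.
Import GRing.Theory.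
Local Open Scope ring_scope.

(** The generating function of [f0] is [X / (1 - a X^2)], and the invert
    transform acts on generating functions without constant term by
    [F |-> F + F^2 + ... = F / (1 - F)], since the coefficient of [X^n] in [F^k]
    sums over the compositions of [n] into [k] parts ([coef_genpolyX]).  It sends
    [X / (1 - c X - a X^2)] to [X / (1 - (c + 1) X - a X^2)] ([invert_lucas]), so
    [f_m] has generating function [X / (1 - m X - a X^2)]: it is the Lucas
    sequence [U 0 = 0], [U 1 = 1], [U (n + 2) = m U (n + 1) + a U n].  Pascal's
    rule shows that the binomial sum satisfies this recurrence as well
    ([lucas_binE]).

    The power series are represented by polynomials modulo [X^(N + 1)], where
    [N] is any bound on the indices of interest.  The relation
    [F (1 - c X - a X^2) = X] modulo [X^(N + 1)] then says exactly that the
    coefficients of [F] up to [N] form the Lucas sequence ([lucas_denP]). *)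

Section Invert.

Variable R : comNzRingType.
Implicit Types (f : nat -> R) (p q s : {poly R}) (a c : R).

Definition eqtrunc N p q := forall n, (n <= N)%N -> p`_n = q`_n.

Lemma eqtruncM N p p' q q' :
  eqtrunc N p p' -> eqtrunc N q q' -> eqtrunc N (p * q) (p' * q').
Proof.
move=> eqp eqq n leN; rewrite !coefM; apply: eq_bigr => i _.
by rewrite eqp ?eqq // (leq_trans _ leN) ?leq_subr // -ltnS.
Qed.

Lemma eqtruncX N p q k : eqtrunc N p q -> eqtrunc N (p ^+ k) (q ^+ k).
Proof.
move=> eqp; elim: k => [|k IHk]; first by rewrite !expr0.
by rewrite !exprS; apply: eqtruncM.
Qed.

Lemma coefX_small p k n : p`_0 = 0 -> (n < k)%N -> (p ^+ k)`_n = 0.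
Proof.
move=> p0; elim: k n => // k IHk n ltnk; rewrite exprS coefM big1 // => -[i lein] _ /=.
by case: i lein => [|i] lein; rewrite ?p0 ?mul0r // IHk ?mulr0 //; lia.
Qed.

(** The value of [f] at 0, about which nothing is assumed, is replaced by 0. *)
Definition genpoly f N : {poly R} := \poly_(i < N.+1) (f i *+ (0 < i)%N).

Lemma genpoly0 f N : (genpoly f N)`_0 = 0.
Proof. by rewrite coef_poly. Qed.

(** Expanding the power gives one monomial for each [k]-tuple of exponents; a
    tuple with a zero entry contributes 0, and the degree selects the sum. *)
Lemma coef_genpolyX f n k :
  (genpoly f n ^+ k)`_n =
    \sum_(i : {ffun 'I_k -> 'I_n.+1} |
            [forall j, (0 < i j)%N] && ((\sum_(j < k) (i j : nat))%N == n))
      \prod_(j < k) f (i j).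
Proof.
have -> : genpoly f n ^+ k =
    \prod_(j < k) \sum_(i < n.+1) ((f i *+ (0 < i)%N) *: 'X^i).
  by rewrite prodr_const card_ord /genpoly poly_def.
rewrite bigA_distr_bigA /= coef_sum [RHS]big_mkcond; apply: eq_bigr => i _.
rewrite scaler_prod prodrXr coefZ coefXn eq_sym.
case: forallP => [pos | notpos] /=.
  rewrite (eq_bigr (fun j => f (i j))) => [|j _]; last by rewrite pos.
  by case: eqP; rewrite ?mulr1 ?mulr0.
have [j /negPf i0] : exists j, ~~ (0 < i j)%N.
  by apply/existsP; rewrite -negb_forall; apply/forallP.
by rewrite (bigD1 j) //= i0 mulr0n !mul0r.
Qed.

(** A common truncation order [N] serves all the indices [n <= N]: the powers
    beyond the [n]-th have no coefficient in degree [n]. *)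
Lemma invert_coef f n N : (n <= N)%N ->
  invert f n = (\sum_(1 <= k < N.+1) genpoly f N ^+ k)`_n.
Proof.
move=> leN; rewrite coef_sum (@big_cat_nat _ _ _ n.+1) //=.
rewrite [X in _ = _ + X]big_nat [X in _ = _ + X]big1 ?addr0; last first.
  by move=> k /andP[ltnk _]; rewrite coefX_small ?genpoly0.
apply: eq_bigr => k _; rewrite -coef_genpolyX; apply: (@eqtruncX n) => // i lein.
by rewrite !coef_poly !ltnS lein (leq_trans lein leN).
Qed.

Fixpoint lucas c a n : R :=
  if n is n1.+1 then
    if n1 is n2.+1 then c * lucas c a n1 + a * lucas c a n2 else 1
  else 0.

Lemma lucasSS c a n :
  lucas c a n.+2 = c * lucas c a n.+1 + a * lucas c a n.
Proof. by []. Qed.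

Lemma lucas_unique c a (u : nat -> R) N :
    u 0%N = 0 -> u 1%N = 1 ->
    (forall n, (n.+2 <= N)%N -> u n.+2 = c * u n.+1 + a * u n) ->
  forall n, (n <= N)%N -> u n = lucas c a n.
Proof.
move=> u0 u1 uSS n; elim/ltn_ind: n => -[|[|n]] IHn leN //.
by rewrite uSS // lucasSS !IHn //; lia.
Qed.

Definition lucas_den c a : {poly R} := 1 - c *: 'X - a *: 'X^2.

Lemma coefM_lucas_den s c a n :
  (s * lucas_den c a)`_n =
    s`_n - c * (if n is n1.+1 then s`_n1 else 0)
         - a * (if n is n2.+2 then s`_n2 else 0).
Proof.
rewrite /lucas_den !mulrBr mulr1 -!scalerAr !coefB !coefZ coefMX coefMXn.
by case: n => [|[|n]] //=; rewrite subn2.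
Qed.

Lemma lucas_denP s c a N :
  eqtrunc N (s * lucas_den c a) 'X <->
  (forall n, (n <= N)%N -> s`_n = lucas c a n).
Proof.
split=> [sden | sE] n leN.
  have s0 : s`_0 = 0.
    have := sden 0%N (leq0n _).
    by rewrite coefM_lucas_den coefX /= !mulr0 !subr0.
  case: n leN => // n ltnN; apply: (@lucas_unique _ _ _ N) => //.
    have := sden 1%N (leq_ltn_trans (leq0n _) ltnN).
    by rewrite coefM_lucas_den coefX /= s0 !mulr0 !subr0.
  move=> k lekN; have := sden _ lekN; rewrite coefM_lucas_den coefX /=.
  by move/eqP; rewrite -addrA -opprD subr_eq0 => /eqP.
rewrite coefM_lucas_den coefX; case: n leN => [|[|n]] leN.
- by rewrite sE //= !mulr0 !subr0.
- by rewrite !sE //= !mulr0 !subr0.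
- by rewrite !sE //= ?lucasSS; [ring | lia..].
Qed.

(** With [Q = 1 - c X - a X^2], [P = X / Q] and [S = P / (1 - P)], clearing
    denominators in [S (1 - P) = P] gives [S (Q - X) = X], and [Q - X] is the
    denominator for [c + 1]. *)
Lemma invert_lucas f c a :
    (forall n, (0 < n)%N -> f n = lucas c a n) ->
  forall n, (0 < n)%N -> invert f n = lucas (c + 1) a n.
Proof.
move=> fE N _; rewrite (invert_coef f (leqnn N)).
set P := genpoly f N; set S := \sum_(1 <= k < N.+1) P ^+ k.
apply: (proj1 (lucas_denP S (c + 1) a N)) => // n leN.
have PQ : eqtrunc N (P * lucas_den c a) 'X.
  apply/lucas_denP => -[|i] leiN; first by rewrite genpoly0.
  by rewrite coef_poly ltnS leiN fE.
have geom : S - P * S = P - P ^+ N.+1.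
  rewrite /S big_distrr -sumrB /= (eq_bigr (fun k => - (P ^+ k.+1 - P ^+ k))).
    by rewrite sumrN telescope_sumr // opprB.
  by move=> k _; rewrite -exprS opprB.
have -> : S * lucas_den (c + 1) a =
    P * lucas_den c a - P ^+ N.+1 * lucas_den c a
      + S * (P * lucas_den c a) - S * 'X.
  rewrite -mulrBl -geom /lucas_den scalerDl scale1r; ring.
rewrite coefB !coefD coefN.
(* The tail [P ^+ N.+1] left by the geometric sum vanishes to order [N]. *)
rewrite (PQ n leN) (@eqtruncM N S S _ _ _ PQ n leN) //.
rewrite (@eqtruncM N (P ^+ N.+1) 0 _ (lucas_den c a) _ _ n leN) //; last first.
  by move=> i leiN; rewrite coefX_small ?genpoly0 ?coef0.
by rewrite mul0r coef0 subr0 addrK.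
Qed.

Definition lucas_term c a n j : R := c ^+ (n - 2 * j) * a ^+ j * 'C(n - j, j)%:R.

Lemma lucas_term_small c a n j : (n < 2 * j)%N -> lucas_term c a n j = 0.
Proof. by move=> ltnj; rewrite /lucas_term bin_small ?mulr0 //; lia. Qed.

(** Pascal's rule, term by term. *)
Lemma lucas_termSS c a n j : (j <= n)%N ->
  lucas_term c a n.+2 j.+1 = c * lucas_term c a n.+1 j.+1 + a * lucas_term c a n j.
Proof.
move=> lejn; rewrite /lucas_term.
have -> : (n.+2 - 2 * j.+1 = n - 2 * j)%N by lia.
have -> : (n.+2 - j.+1 = (n - j).+1)%N by lia.
rewrite subSS binS natrD exprS.
(* The truncated exponent of [c] in degree [n.+1] is one too large exactly
   when the binomial coefficient vanishes. *)
have [ltjn | geqjn] := ltnP (2 * j) n.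
  have -> : (n - 2 * j = (n.+1 - 2 * j.+1).+1)%N by lia.
  rewrite exprS; ring.
rewrite (@bin_small (n - j) j.+1); last by lia.
ring.
Qed.

Lemma lucas_binE c a n :
  lucas c a n.+1 = \sum_(0 <= j < (n %/ 2).+1) lucas_term c a n j.
Proof.
(* Summing up to [n] keeps the range independent of the parity of [n]. *)
have -> : \sum_(0 <= j < (n %/ 2).+1) lucas_term c a n j =
          \sum_(0 <= j < n.+1) lucas_term c a n j.
  rewrite [RHS](@big_cat_nat _ _ _ (n %/ 2).+1) //=; last by lia.
  rewrite [X in _ = _ + X]big_nat [X in _ = _ + X]big1 ?addr0 // => j /andP[ltj _].
  by apply: lucas_term_small; lia.
elim/ltn_ind: n => -[|[|n]] IHn.
- by rewrite big_nat1 /lucas_term /= bin0 !expr0 !mulr1.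
- rewrite big_nat_recr // big_nat1 (@lucas_term_small _ _ _ 1) //=.
  by rewrite /lucas_term /= bin0 expr1 expr0 !mulr1 mulr0.
rewrite lucasSS !IHn //.
rewrite [in RHS]big_nat_recl // [in RHS]big_nat_recr //=.
rewrite (@lucas_term_small _ _ _ n.+2); last by lia.
rewrite addr0 [in RHS](eq_big_nat _ _ (F2 := fun j =>
    c * lucas_term c a n.+1 j.+1 + a * lucas_term c a n j)); last first.
  by move=> j /andP[_ ltjn]; apply: lucas_termSS.
rewrite big_split /= -!mulr_sumr big_nat_recl // mulrDr -addrA.
by congr (_ + _); rewrite /lucas_term muln0 !subn0 !bin0 !expr0 !mulr1 -exprS.
Qed.

End Invert.

Theorem proposition7 (a : int) (m : nat) (f0 : nat -> int)
    (ha : 1 <= a)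
    (hf1 : f0 1%N = 1)
    (hf2 : f0 2%N = 0)
    (hfrec : forall n : nat, (1 <= n)%N -> f0 (n + 2)%N = a * f0 n)
    (n : nat) (hn : (1 <= n)%N) :
  iter m (@invert int) f0 n =
    \sum_(0 <= j < ((n - 1) %/ 2).+1)
      m%:Z ^+ (n - 2 * j - 1) * a ^+ j * ('C(n - 1 - j, j))%:Z.
Proof.
have f0E k : (0 < k)%N -> f0 k = lucas 0 a k.
  elim/ltn_ind: k => -[|[|[|k]]] IHk // _.
    by rewrite hf2 /= mul0r mulr0 addr0.
  by have := hfrec k.+1 isT; rewrite addn2 => ->; rewrite lucasSS mul0r add0r IHk.
have fmE : forall k, (0 < k)%N -> iter m (@invert int) f0 k = lucas m%:Z a k.
  elim: m => // m IHm k k_gt0.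
  by rewrite iterS (invert_lucas IHm) // addrC -intS.
rewrite fmE //; case: n hn => // n _; rewrite lucas_binE subn1 /=.
apply: eq_bigr => j _; rewrite /lucas_term natz.
by congr (_ ^+ _ * _ * _); lia.
Qed.
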